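(* Let $n$ be a positive integer. The polynomial $r_2(n,q)$ (in the variable $q$) has a negative coefficient if and only if some of the prime factors of $n$ are congruent to $3$ modulo $4$ (that is, at least one prime factor of $n$ is congruent to $3$ modulo $4$).
   Context: For $n \geq 1$, $r_2(n,q)$ is defined as the coefficient of $t^n$ in the expansion, as a formal power series in $t$ with coefficients in $\mathbb{Z}[q,q^{-1}]$, $$\prod_{m=1}^{\infty} \frac{\left(1-(-qt)^m\right)^2}{\left(1+q(-qt)^m\right)\left(1+q^{-1}(-qt)^m\right)} = 1 + \sum_{n=1}^{\infty} r_2(n,q)\, t^n ;$$ each $r_2(n,q)$ is in fact a polynomial in $q$ with integer coefficients. *)

(* Defs.v *)
From HB Require Import structures.
From mathcomp Require Import all_boot all_order all_algebra.
From mathcomp Require Import boolp.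

Set Implicit Arguments.
Unset Strict Implicit.
Unset Printing Implicit Defensive.

Import Order.TTheory GRing.Theory Num.Theory.
Local Open Scope ring_scope.

(* Formal power series in one variable. The wrapper keeps the Cauchy product
   below apart from the pointwise ring structure on functions. *)
Record fps (R : Type) := FPS { fps_coef :> nat -> R }.

HB.instance Definition _ (R : Type) := gen_eqMixin (fps R).
HB.instance Definition _ (R : Type) := gen_choiceMixin (fps R).

Lemma fpsP (R : Type) (f g : fps R) : f =1 g -> f = g.
Proof. by case: f => f; case: g => g /= /funext ->. Qed.

Section FpsRing.
Variable R : comUnitRingType.
Implicit Types f g h : fps R.

Definition fps_add f g := FPS (fun n => f n + g n).
Definition fps_opp f := FPS (fun n => - f n).
Definition fpsC (c : R) := FPS (fun n => c *+ (n == 0)).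
Definition fps_mul f g := FPS (fun n => \sum_(i < n.+1) f i * g (n - i)%N).

Fact fps_addA : associative fps_add.
Proof. by move=> f g h; apply: fpsP => n /=; rewrite addrA. Qed.
Fact fps_addC : commutative fps_add.
Proof. by move=> f g; apply: fpsP => n /=; rewrite addrC. Qed.
Fact fps_add0 : left_id (fpsC 0) fps_add.
Proof. by move=> f; apply: fpsP => n /=; rewrite mul0rn add0r. Qed.
Fact fps_addN : left_inverse (fpsC 0) fps_opp fps_add.
Proof. by move=> f; apply: fpsP => n /=; rewrite mul0rn addNr. Qed.

HB.instance Definition _ := GRing.isZmodule.Build (fps R)
  fps_addA fps_addC fps_add0 fps_addN.

Fact fps_mulC : commutative fps_mul.
Proof.
move=> f g; apply: fpsP => n /=; rewrite (reindex_inj rev_ord_inj) /=.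
apply: eq_bigr => i _; have le_in : (i <= n)%N by rewrite -ltnS.
by rewrite subSS subKn // mulrC.
Qed.

(* Associativity and the like are read off from truncations in {poly R}. *)
Definition fps_trunc n f : {poly R} := \poly_(i < n) f i.

Fact fps_trunc_mul n f g k : (k < n)%N ->
  fps_mul f g k = (fps_trunc n f * fps_trunc n g)`_k.
Proof.
move=> kn; rewrite coefM /=; apply: eq_bigr => i _; rewrite !coef_poly.
have ik : (i <= k)%N by rewrite -ltnS.
by rewrite (leq_ltn_trans ik kn) (leq_ltn_trans (leq_subr _ _) kn).
Qed.

Fact fps_mulA : associative fps_mul.
Proof.
move=> f g h; apply: fpsP => n.
have lt_n i : (n - i < n.+1)%N by rewrite ltnS leq_subr.
transitivity ((fps_trunc n.+1 f * (fps_trunc n.+1 g * fps_trunc n.+1 h))`_n).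
  rewrite coefM; apply: eq_bigr => i _.
  by rewrite coef_poly ltn_ord -(@fps_trunc_mul n.+1) // lt_n.
rewrite mulrA coefM; apply: eq_bigr => i _.
by rewrite -(@fps_trunc_mul n.+1) ?ltn_ord // coef_poly lt_n.
Qed.

Fact fps_mul1 : left_id (fpsC 1) fps_mul.
Proof.
move=> f; apply: fpsP => n /=; rewrite big_ord_recl /= subn0 mul1r.
by rewrite big1 ?addr0 // => i _; rewrite mul0r.
Qed.

Fact fps_mulDl : left_distributive fps_mul fps_add.
Proof.
move=> f g h; apply: fpsP => n /=; rewrite -big_split /=.
by apply: eq_bigr => i _; rewrite mulrDl.
Qed.

Fact fps_one_neq0 : fpsC 1 != 0.
Proof.
apply/eqP => /(congr1 (fun f : fps R => f 0)) /= /eqP.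
by rewrite !mulr1n oner_eq0.
Qed.

HB.instance Definition _ := GRing.Zmodule_isComNzRing.Build (fps R)
  fps_mulA fps_mulC fps_mul1 fps_mulDl fps_one_neq0.

Lemma fps_coefD f g n : (f + g) n = f n + g n. Proof. by []. Qed.
Lemma fps_coefN f n : (- f) n = - f n. Proof. by []. Qed.
Lemma fps_coefB f g n : (f - g) n = f n - g n. Proof. by []. Qed.
Lemma fps_coef0 n : (0 : fps R) n = 0. Proof. exact: mul0rn. Qed.
Lemma fps_coef1 n : (1 : fps R) n = (n == 0)%:R. Proof. by []. Qed.
Lemma fps_coefM f g n : (f * g) n = \sum_(i < n.+1) f i * g (n - i)%N.
Proof. by []. Qed.
Lemma fps_coef0M f g : (f * g) 0 = f 0 * g 0.
Proof. by rewrite fps_coefM big_ord_recl big_ord0 addr0. Qed.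

(* fps_inv_seq f n lists the coefficients 0, ..., n of 1 / f when f 0 is
   a unit: b_0 = 1 / f_0 and b_(n+1) = - (1 / f_0) \sum_(i <= n) f_(i+1) b_(n-i) *)
Fixpoint fps_inv_seq f n : seq R :=
  if n is n'.+1 then
    let s := fps_inv_seq f n' in
    rcons s (- (f 0)^-1 * \sum_(i < n) f i.+1 * s`_(n' - i))
  else [:: (f 0)^-1].

Definition fps_unit f := f 0 \is a GRing.unit.
Definition fps_inv f :=
  if fps_unit f then FPS (fun n => (fps_inv_seq f n)`_n) else f.

Lemma size_fps_inv_seq f n : size (fps_inv_seq f n) = n.+1.
Proof. by elim: n => //= n IH; rewrite size_rcons IH. Qed.

Lemma nth_fps_inv_seq f n k : (k <= n)%N ->
  (fps_inv_seq f n)`_k = (fps_inv_seq f k)`_k.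
Proof.
elim: n => [|n IH]; first by rewrite leqn0 => /eqP ->.
rewrite leq_eqVlt => /orP[/eqP -> //|]; rewrite ltnS => kn.
by rewrite -IH //= nth_rcons size_fps_inv_seq ltnS kn.
Qed.

Lemma fps_inv0 f : f 0 \is a GRing.unit -> fps_inv f 0 = (f 0)^-1.
Proof. by rewrite /fps_inv /fps_unit => ->. Qed.

Lemma fps_invS f n : f 0 \is a GRing.unit ->
  fps_inv f n.+1 = - (f 0)^-1 * \sum_(i < n.+1) f i.+1 * fps_inv f (n - i)%N.
Proof.
rewrite /fps_inv /fps_unit => -> /=.
rewrite nth_rcons size_fps_inv_seq ltnn eqxx; congr (_ * _).
by apply: eq_bigr => i _; rewrite nth_fps_inv_seq ?leq_subr.
Qed.

Fact fps_mulVr : {in fps_unit, left_inverse 1 fps_inv *%R}.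
Proof.
move=> f; rewrite unfold_in => uf; rewrite mulrC; apply: fpsP => -[|n].
  by rewrite fps_coef0M fps_inv0 // mulrV.
rewrite fps_coefM big_ord_recl subn0 fps_invS // mulrA mulrN mulrV // mulN1r.
by rewrite addNr.
Qed.

Fact fps_unitPl f g : g * f = 1 -> fps_unit f.
Proof.
move/(congr1 (fun h : fps R => h 0)); rewrite fps_coef0M => gf1.
by apply/unitrPr; exists (g 0); rewrite mulrC.
Qed.

Fact fps_inv_out : {in [predC fps_unit], fps_inv =1 id}.
Proof. by rewrite /fps_inv => f nf; rewrite ifN. Qed.

HB.instance Definition _ := GRing.ComNzRing_hasMulInverse.Build (fps R)
  fps_mulVr fps_unitPl fps_inv_out.

Lemma fps_unitE f : (f \is a GRing.unit) = (f 0 \is a GRing.unit).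
Proof. by []. Qed.

Lemma fps_coef0V f : f 0 \is a GRing.unit -> f^-1 0 = (f 0)^-1.
Proof. exact: fps_inv0. Qed.
Lemma fps_coefSV f n : f 0 \is a GRing.unit ->
  f^-1 n.+1 = - (f 0)^-1 * \sum_(i < n.+1) f i.+1 * f^-1 (n - i)%N.
Proof. exact: fps_invS. Qed.

Definition fpsX : fps R := FPS (fun n => (n == 1)%:R).

Lemma fps_coefCM c f n : (fpsC c * f) n = c * f n.
Proof.
rewrite fps_coefM big_ord_recl subn0 big1 ?addr0 // => i _.
by rewrite /= mul0r.
Qed.

Lemma fps_coefXM f n : (fpsX * f) n = if n is n'.+1 then f n' else 0.
Proof.
rewrite fps_coefM; case: n => [|n]; first by rewrite big_ord_recl big_ord0 mul0r addr0.
rewrite big_ord_recl mul0r add0r big_ord_recl mul1r subSS subn0.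
by rewrite big1 ?addr0 // => i _; rewrite mul0r.
Qed.

Lemma fps_coefCXn c m n : ((fpsC c * fpsX) ^+ m) n = c ^+ m *+ (n == m).
Proof.
elim: m n => [|m IH] n; first by rewrite !expr0.
rewrite !exprS -mulrA fps_coefCM fps_coefXM.
by case: n => [|n]; rewrite ?mulr0 // IH mulrnAr.
Qed.

Fact fpsC_is_zmod_morphism : zmod_morphism fpsC.
Proof. by move=> a b; apply: fpsP => n /=; rewrite mulrnBl. Qed.
Fact fpsC_is_monoid_morphism : monoid_morphism fpsC.
Proof. by split=> // a b; apply: fpsP => n; rewrite fps_coefCM /= mulrnAr. Qed.

HB.instance Definition _ :=
  GRing.isZmodMorphism.Build R (fps R) fpsC fpsC_is_zmod_morphism.
HB.instance Definition _ :=
  GRing.isMonoidMorphism.Build R (fps R) fpsC fpsC_is_monoid_morphism.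

(* Convergence of \prod_(m >= 1) F m to P in the t-adic topology. *)
Definition fps_prod_cvg (F : nat -> fps R) (P : fps R) : Prop :=
  forall n, exists N, forall M, (N <= M)%N ->
    (\prod_(1 <= m < M.+1) F m) n = P n.

(* The infinite product \prod_(m >= 1) F m of factors F m in 1 + (t^m): its
   coefficient of t^n is already that of the product over m <= n. *)
Definition fps_infprod (F : nat -> fps R) : fps R :=
  FPS (fun n => (\prod_(1 <= m < n.+1) F m) n).

Lemma fps_infprod_stable (F : nat -> fps R) n M :
  (forall m k, (k < m)%N -> F m k = (k == 0)%:R) -> (n <= M)%N ->
  (\prod_(1 <= m < M.+1) F m) n = fps_infprod F n.
Proof.
move=> F1; elim: M => [|M IH]; first by rewrite leqn0 => /eqP ->.
rewrite leq_eqVlt => /orP[/eqP -> //|]; rewrite ltnS => nM; rewrite -IH //.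
have -> : \prod_(1 <= m < M.+2) F m = F M.+1 * \prod_(1 <= m < M.+1) F m.
  by rewrite big_nat_recr // mulrC.
rewrite fps_coefM big_ord_recl subn0 F1 // mul1r.
rewrite [X in _ + X]big1 ?addr0 // => i _; rewrite F1 ?mul0r // ltnS.
by rewrite (leq_trans _ nM) // lift0.
Qed.

Lemma fps_infprodP (F : nat -> fps R) :
  (forall m k, (k < m)%N -> F m k = (k == 0)%:R) ->
  fps_prod_cvg F (fps_infprod F).
Proof. by move=> F1 n; exists n => M; apply: fps_infprod_stable. Qed.

End FpsRing.

Arguments fpsX {R}.

(* Z[q, q^-1] is used inside the fraction field of Z[q]; as the factors have
   coefficients in Z[q, q^-1] and constant term 1, their expansion in t does
   not depend on this embedding. *)
Notation Zq := {fraction {poly int}}.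

Definition qvar : Zq := tofrac 'X.

Definition negqt : fps Zq := - (fpsC qvar * fpsX).

Definition r2_factor (m : nat) : fps Zq :=
  (1 - negqt ^+ m) ^+ 2
  / ((1 + fpsC qvar * negqt ^+ m) * (1 + fpsC qvar^-1 * negqt ^+ m)).

Definition r2_series : fps Zq := fps_infprod r2_factor.

Lemma negqtXn m : negqt ^+ m = FPS (fun n => (- qvar) ^+ m *+ (n == m)).
Proof.
by apply: fpsP => n; rewrite /negqt -mulNr -rmorphN fps_coefCXn.
Qed.

Lemma coef_C_negqtXn (c : Zq) m n :
  (fpsC c * negqt ^+ m) n = c * (- qvar) ^+ m *+ (n == m).
Proof. by rewrite fps_coefCM negqtXn /= mulrnAr. Qed.

Definition fps_Zpoly (f : fps Zq) := forall n, exists P : {poly int}, f n = tofrac P.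

Lemma fps_Zpoly1 : fps_Zpoly 1.
Proof. by move=> n; exists (n == 0)%:R; rewrite fps_coef1 rmorph_nat. Qed.

Lemma fps_ZpolyD (f g : fps Zq) : fps_Zpoly f -> fps_Zpoly g -> fps_Zpoly (f + g).
Proof.
by move=> Ff Fg n; have [[P fE] [Q gE]] := (Ff n, Fg n);
  exists (P + Q); rewrite fps_coefD fE gE rmorphD.
Qed.

Lemma fps_ZpolyN (f : fps Zq) : fps_Zpoly f -> fps_Zpoly (- f).
Proof.
by move=> Ff n; have [P fE] := Ff n; exists (- P); rewrite fps_coefN fE rmorphN.
Qed.

Lemma Zpoly_sum n (F G : nat -> Zq) :
  (forall i, (i < n)%N -> exists P : {poly int}, F i = tofrac P) ->
  (forall i, (i < n)%N -> exists P : {poly int}, G i = tofrac P) ->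
  exists P : {poly int}, \sum_(i < n) F i * G i = tofrac P.
Proof.
move=> FP GP; apply: (big_ind (fun x : Zq => exists P : {poly int}, x = tofrac P)).
- by exists 0; rewrite rmorph0.
- by move=> _ _ [P ->] [Q ->]; exists (P + Q); rewrite rmorphD.
- move=> i _; have [P ->] := FP i (ltn_ord i); have [Q ->] := GP i (ltn_ord i).
  by exists (P * Q); rewrite rmorphM.
Qed.

Lemma fps_ZpolyM (f g : fps Zq) : fps_Zpoly f -> fps_Zpoly g -> fps_Zpoly (f * g).
Proof.
by move=> Ff Fg n; rewrite fps_coefM; apply: (@Zpoly_sum n.+1 f (fun i => g (n - i)%N)).
Qed.

Lemma fps_ZpolyX (f : fps Zq) m : fps_Zpoly f -> fps_Zpoly (f ^+ m).
Proof.
move=> Ff; elim: m => [|m IH]; first exact: fps_Zpoly1.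
by rewrite exprS; apply: fps_ZpolyM.
Qed.

Lemma fps_ZpolyV (f : fps Zq) : f 0 = 1 -> fps_Zpoly f -> fps_Zpoly f^-1.
Proof.
move=> f1 Ff n; have uf : f 0 \is a GRing.unit by rewrite f1 unitr1.
elim/ltn_ind: n => -[|n] IH.
  by exists 1; rewrite (fps_coef0V uf) f1 invr1 rmorph1.
have [P PE] : exists P : {poly int},
    \sum_(i < n.+1) f i.+1 * f^-1 (n - i)%N = tofrac P.
  apply: (@Zpoly_sum n.+1 (fun i => f i.+1) (fun i => f^-1 (n - i)%N)) => i _ //.
  by apply: IH; rewrite ltnS leq_subr.
by exists (- P); rewrite (fps_coefSV _ uf) f1 invr1 mulN1r PE rmorphN.
Qed.

Lemma r2_denom0 (c : Zq) m : (0 < m)%N -> (1 + fpsC c * negqt ^+ m) 0 = 1.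
Proof.
by case: m => // m _; rewrite fps_coefD coef_C_negqtXn mulr0n addr0.
Qed.

Lemma r2_factor_low m k : (k < m)%N -> r2_factor m k = (k == 0)%:R.
Proof.
move=> km; have m_gt0 := leq_ltn_trans (leq0n k) km.
pose low (f : fps Zq) := forall j, (j < m)%N -> f j = (j == 0)%:R.
have lowM f g : low f -> low g -> low (f * g).
  move=> lf lg j jm; rewrite fps_coefM big_ord_recl lf // subn0 mul1r lg //.
  rewrite big1 ?addr0 // => i _; rewrite lf ?mul0r //.
  by apply: leq_ltn_trans jm; rewrite lift0.
have low1 (c : Zq) : low (1 + fpsC c * negqt ^+ m).
  by move=> j jm; rewrite fps_coefD coef_C_negqtXn (ltn_eqF jm) addr0.
have lowV f : low f -> low f^-1.
  move=> lf; have uf : f 0 \is a GRing.unit by rewrite lf ?unitr1.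
  elim/ltn_ind => -[|j] IH jm; first by rewrite fps_coef0V // lf // invr1.
  rewrite fps_coefSV // big1 ?mulr0 // => i _.
  by rewrite lf ?mul0r // (leq_ltn_trans _ jm).
apply: (lowM _ _ _ (lowV _ (lowM _ _ (low1 _) (low1 _)))) => //.
have -> : 1 - negqt ^+ m = 1 + fpsC (-1) * negqt ^+ m by rewrite rmorphN1 mulN1r.
by rewrite expr2; apply: (lowM _ _ (low1 _) (low1 _)).
Qed.

Lemma r2_series_cvg : fps_prod_cvg r2_factor r2_series.
Proof. exact: fps_infprodP r2_factor_low. Qed.

Lemma r2_series0 : r2_series 0 = 1.
Proof. by rewrite /= big_geq. Qed.

Lemma r2_factor_Zpoly m : (0 < m)%N -> fps_Zpoly (r2_factor m).
Proof.
have q_neq0 : qvar != 0 by rewrite tofrac_eq0 polyX_eq0.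
move=> m_gt0.
have mono (c : Zq) (P : {poly int}) : c * (- qvar) ^+ m = tofrac P ->
    fps_Zpoly (fpsC c * negqt ^+ m).
  by move=> cE n; exists (P *+ (n == m)); rewrite coef_C_negqtXn cE rmorphMn.
have mq : fps_Zpoly (fpsC qvar * negqt ^+ m).
  by apply: (mono _ ('X * (- 'X) ^+ m)); rewrite rmorphM rmorphXn rmorphN.
have mqV : fps_Zpoly (fpsC qvar^-1 * negqt ^+ m).
  apply: (mono _ (- (- 'X) ^+ m.-1)).
  rewrite -(prednK m_gt0) exprS mulrA mulrN mulVf // mulN1r /=.
  by rewrite rmorphN rmorphXn rmorphN.
have m1 : fps_Zpoly (negqt ^+ m).
  rewrite -[_ ^+ m]mul1r -(rmorph1 (@fpsC Zq)).
  by apply: (mono _ ((- 'X) ^+ m)); rewrite mul1r rmorphXn rmorphN.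
apply: fps_ZpolyM; first by apply/fps_ZpolyX/fps_ZpolyD/fps_ZpolyN; first exact: fps_Zpoly1.
apply: fps_ZpolyV; first by rewrite fps_coef0M !r2_denom0 ?mulr1.
by apply: fps_ZpolyM; apply: fps_ZpolyD => //; apply: fps_Zpoly1.
Qed.

Lemma r2_series_Zpoly n : exists P : {poly int}, r2_series n == tofrac P.
Proof.
have prodP : fps_Zpoly (\prod_(1 <= m < n.+1) r2_factor m).
  rewrite big_nat; apply: big_ind => [|f g|m /andP[m_gt0 _]].
  - exact: fps_Zpoly1.
  - exact: fps_ZpolyM.
  - exact: r2_factor_Zpoly.
by have [P PE] := prodP n; exists P; apply/eqP.
Qed.

(* By injectivity of tofrac this is the only polynomial satisfying r2P. *)
Definition r2 (n : nat) : {poly int} := xchoose (r2_series_Zpoly n).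

Lemma r2P n : tofrac (r2 n) = r2_series n.
Proof. by rewrite (eqP (xchooseP (r2_series_Zpoly n))). Qed.

(* Main.v *)
Require Import Defs.
From mathcomp Require Import all_boot all_order all_algebra.
From mathcomp Require Import ring zify.

Import Order.TTheory GRing.Theory Num.Theory.
Local Open Scope ring_scope.

(** Put x = -qt and w = -q, so that the generating series is
    prod_(m >= 1) (1 - x^m)^2 / ((1 - w x^m) (1 - w^-1 x^m)).

    Expand it in partial fractions. The product over m <= N is a rational
    function of w + w^-1 with simple poles at x^k + x^-k, 1 <= k <= N, so it is a
    combination of the 1 / ((1 - w x^k) (1 - w^-1 x^k)). The k-th coefficient is,
    up to a factor congruent to 1 modulo x^(N+1-k), equal to
    (-1)^(k+1) x^(k(k-1)/2) (1 - x^k) (1 - x^(2k))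
    ([prod_partial_fractions], [qratio_near1]). As
    (1 - x^(2k)) / ((1 - w x^k) (1 - w^-1 x^k)) is the sum of w^j x^(k|j|) over
    all integers j, letting N grow gives for the coefficient of q^i in r_2(n,q),
    with d = |i - n|, the explicit value [coef_r2]
      sum_(k >= 1) (-1)^(i+k+1) ([2n = k(k+2d-1)] - [2n = k(k+2d+1)]).

    So every contribution comes from a factorization 2n = k l into factors of
    opposite parity. If a is the odd factor and 2b the even one, then n = ab and
    both kinds of contribution turn out to have sign (-1)^((a-1)/2)
    ([odd_factor_sign]). Hence if no divisor of n is 3 modulo 4, all
    coefficients are nonnegative. Conversely a divisor a = 3 modulo 4 of n
    yields a negative contribution, and nothing cancels it: for a fixed d the
    two increasing families k(k+2d-1) and k(k+2d+1) take the value 2n at most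
    once each, and if both do then d = 0 and both contributions have the same
    sign ([coef_r2_lt0]). Finally, n has a divisor that is 3 modulo 4 exactly
    when it has such a prime divisor. *)

(** * Partial fractions of the finite products *)

Section PartialFractions.
Variables (A : comUnitRingType) (x w w' : A).
Hypothesis ww' : w * w' = 1.
Hypothesis unit_1subX : forall m, (0 < m)%N -> 1 - x ^+ m \is a GRing.unit.

Definition theta_factor m := (1 - w * x ^+ m) * (1 - w' * x ^+ m).
Hypothesis unit_theta_factor :
  forall m, (0 < m)%N -> theta_factor m \is a GRing.unit.

(** With (x)_m the product of 1 - x^i for 1 <= i <= m, this is
    (x)_N^2 / ((x)_(N-k) (x)_(N+k)). The truncated subtraction is harmless: for
    k > N the factor j = N vanishes, in agreement with 1 / (x)_(N-k) = 0. *)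
Definition qratio N k : A :=
  \prod_(j < k) ((1 - x ^+ (N - j)) / (1 - x ^+ (N + j).+1)).

Lemma qratioS N k :
  qratio N k.+1 * (1 - x ^+ (N + k).+1) = qratio N k * (1 - x ^+ (N - k)).
Proof. by rewrite /qratio big_ord_recr /= -mulrA divrK // unit_1subX. Qed.

Lemma qratio_out N : qratio N N.+1 = 0.
Proof. by rewrite /qratio big_ord_recr /= subnn subrr mul0r mulr0. Qed.

Lemma qratio_succ N k : (k <= N)%N ->
  qratio N.+1 k * ((1 - x ^+ (N.+1 - k)) * (1 - x ^+ (N.+1 + k)))
  = qratio N k * (1 - x ^+ N.+1) ^+ 2.
Proof.
elim: k => [_|k IH kN]; first by rewrite /qratio !big_ord0 subn0 addn0 expr2.
have u1 : 1 - x ^+ (N + k).+1 \is a GRing.unit by rewrite unit_1subX.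
apply: (mulIr u1).
rewrite [RHS]mulrAC qratioS [RHS]mulrAC -IH ?(ltnW kN) //.
rewrite subSS addnS !addSn.
have := qratioS N.+1 k; rewrite !addSn => E.
set a := 1 - x ^+ (N - k); set b := 1 - x ^+ (N + k).+1.
set c := 1 - x ^+ (N + k).+2 in E *; set d := 1 - x ^+ (N.+1 - k) in E *.
transitivity (qratio N.+1 k.+1 * c * a * b); first by ring.
by rewrite E; ring.
Qed.

(** The N-th partial fraction expansion thus agrees with its limit in low degree,
    with an explicit bound that makes coefficient extraction effective. *)
Lemma qratio_near1 N k : (k <= N)%N ->
  exists h, qratio N k = 1 + x ^+ (N.+1 - k) * h.
Proof.
elim: k => [_|k IH kN]; first by exists 0; rewrite /qratio big_ord0 mulr0 addr0.
have [h hE] := IH (ltnW kN).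
have u1 : 1 - x ^+ (N + k).+1 \is a GRing.unit by rewrite unit_1subX.
pose u := (1 - x ^+ (N + k).+1)^-1.
have uE : u = 1 + x ^+ (N - k) * (x ^+ (k + k).+1 * u).
  rewrite mulrA -exprD addnS addnA subnK 1?ltnW //.
  by apply: (mulrI u1); rewrite mulrDr mulrCA divrr //; ring.
exists (x * h * (1 - x ^+ (N - k)) * u - u + x ^+ (k + k).+1 * u).
rewrite /qratio big_ord_recr /= -/(qratio N k) -/u hE subSS subSn 1?ltnW // exprS.
move: (x ^+ (N - k)) (x ^+ (k + k).+1) uE => e f uE.
transitivity (u - e * u + (x * h * (1 - e) * u) * e); first by ring.
by rewrite {1}uE; ring.
Qed.

(** The limit for N tending to infinity of the coefficient of
    1 / theta_factor k in the partial fraction expansion of the product over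
    m <= N. *)
Definition residue k : A :=
  (-1) ^+ k.+1 * x ^+ 'C(k, 2) * (1 - x ^+ k) * (1 - x ^+ k.*2).

(** The summand is the difference in K of the right-hand side, as the recursion
    [qratioS] shows. The closed form matters at K = N + 1, where its factor
    1 - x^(N+1-K) is 0. *)
Lemma qratio_telescope N K : (K <= N.+1)%N ->
  (1 - x ^+ N) * (\sum_(1 <= k < K.+1)
                    residue k * x ^+ (N.+1 - k) * qratio N.+1 k)
  = (-1) ^+ K.+1 * x ^+ (N + 'C(K, 2)) * (1 - x ^+ K) * (1 - x ^+ K.+1)
    * (1 - x ^+ (N.+1 - K)) * qratio N.+1 K.
Proof.
elim: K => [_|K IH KN].
  by rewrite big_geq // expr0 subrr !(mulr0, mul0r).
rewrite big_nat_recr //= mulrDr IH 1?ltnW //.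
have E := qratioS N.+1 K.
rewrite -[_ * (1 - x ^+ (N.+1 - K)) * qratio _ _]mulrA [_ * qratio N.+1 K]mulrC -E.
rewrite /residue subSS binS bin1 -addnn addnS addSn !exprS !exprD.
have -> : x ^+ N = x ^+ (N - K) * x ^+ K by rewrite -exprD subnK.
move: (x ^+ K) (x ^+ (N - K)) (x ^+ 'C(K, 2)) ((-1) ^+ K) (qratio _ _) => a b c d e.
ring.
Qed.

Lemma residue_sum0 N : (0 < N)%N ->
  \sum_(1 <= k < N.+2) residue k * x ^+ (N.+1 - k) * qratio N.+1 k = 0.
Proof.
move=> N_gt0; apply: (mulrI (unit_1subX _ N_gt0)).
by rewrite qratio_telescope // subnn subrr !(mulr0, mul0r).
Qed.

(** Both theta factors are affine in w + w^-1, with leading coefficients - x^N and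
    - x^k. The remainder is therefore the value of theta_factor N at the zero
    x^k + x^-k of theta_factor k. *)
Lemma theta_factor_sub N k : (k <= N)%N ->
  theta_factor N
  = x ^+ (N - k) * theta_factor k + (1 - x ^+ (N - k)) * (1 - x ^+ (N + k)).
Proof.
move=> kN; rewrite /theta_factor exprD.
have -> : x ^+ N = x ^+ (N - k) * x ^+ k by rewrite -exprD subnK.
move: (x ^+ k) (x ^+ (N - k)) => a b.
transitivity (1 - (w + w') * (b * a) + (w * w') * (b * a) ^+ 2); first by ring.
transitivity (b * (1 - (w + w') * a + (w * w') * a ^+ 2)
              + (1 - b) * (1 - b * a * a)); last by ring.
by rewrite ww'; ring.
Qed.

(** Induction on N. Multiplying the expansion for N + 1 by the new factor and
    applying [theta_factor_sub] returns (1 - x^(N+1))^2 times the expansion for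
    N, plus a sum free of denominators which is 0 by [residue_sum0]. *)
Theorem prod_partial_fractions N : (0 < N)%N ->
  \prod_(1 <= m < N.+1) ((1 - x ^+ m) ^+ 2 / theta_factor m)
  = \sum_(1 <= k < N.+1) residue k * qratio N k / theta_factor k.
Proof.
elim: N => // -[_ _|N IH _].
  rewrite !big_nat1; congr (_ / _).
  have := qratioS 1 0; rewrite /qratio big_ord0 => E.
  rewrite /residue bin_small // expr0 !expr1 mulr1 -signr_odd mul1r.
  rewrite -mulrA [_ * (\prod__ _)]mulrC E subn0 expr1; ring.
rewrite big_nat_recr //= IH //.
have uN := unit_theta_factor _ (ltn0Sn N.+1).
apply: (mulIr uN); rewrite -mulrA divrK //.
rewrite !mulr_suml.
transitivity (\sum_(1 <= k < N.+3)
   residue k * qratio N.+1 k / theta_factor k * (1 - x ^+ N.+2) ^+ 2).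
  by rewrite [RHS]big_nat_recr //= qratio_out mulr0 !mul0r addr0.
rewrite -[LHS]add0r -{1}(residue_sum0 N.+1) // -big_split /=.
rewrite !big_nat; apply: eq_bigr => k /andP[k_gt0]; rewrite ltnS => kN.
have uk := unit_theta_factor _ k_gt0.
(* The top index k = N + 2 does not occur in the smaller expansion; there both
   sides are 0. *)
have E : qratio N.+2 k * ((1 - x ^+ (N.+2 - k)) * (1 - x ^+ (N.+2 + k)))
         = qratio N.+1 k * (1 - x ^+ N.+2) ^+ 2.
  move: kN; rewrite leq_eqVlt => /orP[/eqP ->|]; last first.
    by rewrite ltnS => kN; exact: qratio_succ.
  by rewrite subnn subrr qratio_out !(mul0r, mulr0).
rewrite (theta_factor_sub _ _ kN) mulrDr.
apply: (mulIr uk); rewrite !mulrDl.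
rewrite -[X in _ = _ + X]mulrA [X in _ = X + _]mulrAC.
move: (theta_factor k) uk (theta_factor k)^-1 (mulVr uk) => t _ t' tE.
transitivity ((residue k * x ^+ (N.+2 - k) * qratio N.+2 k) * t
   + residue k * (qratio N.+1 k * (1 - x ^+ N.+2) ^+ 2) * (t' * t)); first by ring.
rewrite -E tE; ring: tE.
Qed.

End PartialFractions.

(** * Coefficients of the generating series *)

Lemma coef_negqtXnM m (f : fps Zq) n :
  (negqt ^+ m * f) n = if (m <= n)%N then (- qvar) ^+ m * f (n - m)%N else 0.
Proof.
elim: m n => [|m IH] n; first by rewrite expr0 !mul1r subn0.
rewrite exprS {1}/negqt -mulNr -rmorphN -!mulrA fps_coefCM fps_coefXM.
case: n => [|n]; first by rewrite mulr0.
rewrite IH ltnS subSS; case: ifP => _; last by rewrite mulr0.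
by rewrite exprS mulrA.
Qed.

(** The geometric series of c x^k, where x = -qt. *)
Definition geom (c : Zq) k : fps Zq :=
  FPS (fun n => if (k %| n)%N then (- qvar) ^+ n * c ^+ (n %/ k) else 0).

Lemma geomV c k : (0 < k)%N -> (1 - fpsC c * negqt ^+ k) * geom c k = 1.
Proof.
move=> k_gt0; apply: fpsP => n; rewrite mulrBl mul1r -mulrA fps_coefB.
rewrite fps_coefCM coef_negqtXnM fps_coef1 [geom c k n]/=.
case: leqP => [kn|nk] /=; last first.
  rewrite mulr0 subr0; case: n nk => [|n] nk.
    by rewrite dvdn0 div0n mul1r.
  by rewrite gtnNdvd.
rewrite (gtn_eqF (leq_trans k_gt0 kn)) -(subnK kn); move: (n - k)%N => m.
rewrite addnK dvdn_addl //.
case: ifP => _; last by rewrite !mulr0 subrr.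
by rewrite divnDr // divnn k_gt0 addn1 exprD exprS mulr0n; ring.
Qed.

(** For c = w and c' = w^-1 the right-hand side is the sum of w^j x^(k|j|) over all
    integers j; the term j = 0 lies in both geometric series. *)
Lemma theta_factor_inv c c' k : (0 < k)%N -> c * c' = 1 ->
  (1 - negqt ^+ k.*2)
    / theta_factor (fps Zq) negqt (fpsC c) (fpsC c') k
  = geom c k + geom c' k - 1.
Proof.
move=> k_gt0 cc'; rewrite /theta_factor.
have [E E'] := (geomV c k k_gt0, geomV c' k k_gt0).
have u : (1 - fpsC c * negqt ^+ k) * (1 - fpsC c' * negqt ^+ k) \is a GRing.unit.
  by apply/unitrPr; exists (geom c k * geom c' k); rewrite mulrACA E E' mulr1.
apply: (mulIr u); rewrite divrK //.
have ww : fpsC c * fpsC c' = 1 by rewrite -rmorphM cc' rmorph1.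
rewrite -addnn exprD.
move: (fpsC c) (fpsC c') (negqt ^+ k) (geom c k) (geom c' k) E E' ww {u}
  => w w' y g g' E E' ww.
transitivity (((1 - w * y) * g) * (1 - w' * y) + ((1 - w' * y) * g') * (1 - w * y)
  - (1 - w * y - w' * y + (w * w') * y * y)); last by ring.
by rewrite E E' ww; ring.
Qed.

(** The coefficient of t^n in x^m times the sum of w^j x^(k|j|) over all integers j,
    at x = -qt and w = -q. It has no negative power of q because j <= n. *)
Definition bilateral_coef (n k m : nat) : {poly int} :=
  if (m <= n)%N && (k %| n - m)%N then
    let j := ((n - m) %/ k)%N in
    (- 'X) ^+ (n + j) + (- 'X) ^+ (n - j) - (- 'X) ^+ n *+ (j == 0%N)
  else 0.

Lemma qvar_neq0 : qvar != 0.
Proof. by rewrite tofrac_eq0 polyX_eq0. Qed.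

Lemma coef_signM (R : comNzRingType) e (p : {poly R}) i :
  ((-1) ^+ e * p)`_i = (-1) ^+ e * p`_i.
Proof.
rewrite -[in LHS]signr_odd -[in RHS]signr_odd !mulr_sign.
by case: odd; rewrite ?coefN.
Qed.

Lemma coef_negXn n i : ((- 'X) ^+ n : {poly int})`_i = (-1) ^+ i * (i == n)%:R.
Proof.
rewrite [in LHS]exprNn coef_signM coefXn.
by case: eqP => [->|_]; rewrite ?mulr0.
Qed.

Lemma coef_bilateral_coef n k m i : (0 < k)%N ->
  (bilateral_coef n k m)`_i
  = (-1) ^+ i * (n == m + k * `|i%:Z - n%:Z|)%N%:R.
Proof.
move=> k_gt0; rewrite /bilateral_coef; set d := `|_|%N.
have [/andP[mn /dvdnP[j jE]]|ndvd] := ifP; last first.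
  rewrite coef0; case: eqP => [nE|]; last by rewrite mulr0.
  by move: ndvd; rewrite {1 2}nE leq_addr addKn dvdn_mulr.
have nE : n = (m + k * j)%N by lia.
rewrite jE mulnK // coefB coefD coefMn !coef_negXn -mulrnAr -mulrDr -mulrBr.
congr (_ * _).
have -> : (n == m + k * d)%N = (j == d) by rewrite nE eqn_add2l eqn_pmul2l.
have jn : (j <= n)%N by nia.
have -> : (j == d) = (i == n + j)%N || (i == n - j)%N by lia.
case: (j =P 0%N) => [->|j0].
  by rewrite addn0 subn0 orbb addrK.
rewrite subr0; have [->|ne] := eqVneq i (n + j)%N; last by rewrite add0r.
by rewrite (_ : (n + j == n - j)%N = false) ?addr0 //; lia.
Qed.

Lemma tofrac_bilateral_coef n k m : (0 < k)%N ->
  (negqt ^+ m * (geom (- qvar) k + geom (- qvar^-1) k - 1)) n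
  = tofrac (bilateral_coef n k m).
Proof.
move=> k_gt0; rewrite coef_negqtXnM /bilateral_coef.
case: leqP => mn; last by rewrite rmorph0.
rewrite fps_coefB fps_coefD fps_coef1 /=.
case: ifP => [kd|nkd]; last first.
  rewrite addr0 sub0r; case: eqP nkd => [->|_ _]; first by rewrite dvdn0.
  by rewrite oppr0 mulr0 rmorph0.
move: kd => /dvdnP[j jE]; rewrite jE mulnK //.
have nE : n = (m + j * k)%N by lia.
have jn : (j <= n)%N by nia.
rewrite rmorphB rmorphD rmorphMn !rmorphXn rmorphN -/qvar.
have q0 : - qvar != 0 by rewrite oppr_eq0 qvar_neq0.
rewrite -invrN exprVn expfB_cond ?(negPf q0) ?add0n //.
rewrite muln_eq0 (gtn_eqF k_gt0) orbF.
rewrite mulrDr mulrDr mulrN !mulrA -!exprD -nE; congr (_ + _ - _).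
case: (j =P 0%N) => [j0|_]; last by rewrite mulr0.
by rewrite j0 in nE; rewrite nE addn0 mulr1.
Qed.

Lemma residue_theta k : (0 < k)%N ->
  residue (fps Zq) negqt k
    / theta_factor (fps Zq) negqt (fpsC (- qvar)) (fpsC (- qvar^-1)) k
  = (-1) ^+ k.+1
    * (negqt ^+ 'C(k, 2) * (geom (- qvar) k + geom (- qvar^-1) k - 1)
     - negqt ^+ 'C(k.+1, 2) * (geom (- qvar) k + geom (- qvar^-1) k - 1)).
Proof.
move=> k_gt0; rewrite /residue -[LHS]mulrA theta_factor_inv //; last first.
  by rewrite mulrNN mulfV // qvar_neq0.
by rewrite binS bin1 exprD; ring.
Qed.

Lemma negqt_lowM m (f : fps Zq) n : (n < m)%N -> (negqt ^+ m * f) n = 0.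
Proof. by rewrite coef_negqtXnM ltnNge => /negPf ->. Qed.

(** The coefficient of t^n is read off from the product of n + 1 factors. The
    corrections of [qratio_near1] start at x^(k(k-1)/2 + n + 2 - k), and this
    exponent exceeds n for every k >= 1. *)
Lemma r2_seriesE n :
  r2_series n = \sum_(1 <= k < n.+2) (-1) ^+ k.+1 *
     (tofrac (bilateral_coef n k 'C(k, 2)) - tofrac (bilateral_coef n k 'C(k.+1, 2))).
Proof.
rewrite -(fps_infprod_stable r2_factor_low (leqnSn n)).
have cc' : fpsC (- qvar) * fpsC (- qvar^-1) = 1.
  by rewrite -rmorphM mulrNN mulfV ?rmorph1 // qvar_neq0.
have u1 m : (0 < m)%N -> 1 - negqt ^+ m \is a GRing.unit.
  move=> m_gt0; rewrite fps_unitE fps_coefB negqtXn /= ltn_eqF //.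
  by rewrite mulr0n subr0 unitr1.
have fE c m : 1 - fpsC (- c) * negqt ^+ m = 1 + fpsC c * negqt ^+ m.
  by rewrite rmorphN mulNr opprK.
have ut m : (0 < m)%N ->
    theta_factor _ negqt (fpsC (- qvar)) (fpsC (- qvar^-1)) m \is a GRing.unit.
  move=> m_gt0; rewrite /theta_factor !fE fps_unitE fps_coef0M !r2_denom0 //.
  by rewrite mulr1 unitr1.
have -> : \prod_(1 <= m < n.+2) r2_factor m = \prod_(1 <= m < n.+2)
   ((1 - negqt ^+ m) ^+ 2
     / theta_factor _ negqt (fpsC (- qvar)) (fpsC (- qvar^-1)) m).
  by apply: eq_bigr => m _; rewrite /r2_factor /theta_factor !fE.
rewrite (prod_partial_fractions _ _ _ _ cc' u1 ut) //.
have fps_coef_sum (F : nat -> fps Zq) (s : seq nat) :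
    (\sum_(k <- s) F k) n = \sum_(k <- s) F k n.
  by elim/big_rec2: _ => [|k a b _ <-]; rewrite ?fps_coef0.
rewrite fps_coef_sum !big_nat; apply: eq_bigr => k /andP[k_gt0 kn].
have [h ->] := qratio_near1 _ _ u1 n.+1 k kn.
rewrite mulrDr mulr1 mulrDl fps_coefD residue_theta //.
have -> : ((-1) ^+ k.+1 : fps Zq) = fpsC ((-1) ^+ k.+1).
  by rewrite rmorphXn rmorphN1.
rewrite fps_coefCM fps_coefB !tofrac_bilateral_coef //.
have low : (n < 'C(k, 2) + (n.+2 - k))%N.
  by case: k k_gt0 kn => // k _ kn; rewrite binS bin1; lia.
rewrite -[RHS]addr0; congr (_ + _).
rewrite -[RHS](negqt_lowM _ ((-1) ^+ k.+1 * (1 - negqt ^+ k) * (1 - negqt ^+ k.*2)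
    * h / theta_factor _ negqt (fpsC (- qvar)) (fpsC (- qvar^-1)) k) _ low).
by congr (fps_coef _ n); rewrite /residue exprD; ring.
Qed.

Definition low_value k d := ('C(k, 2) + k * d)%N.
Definition high_value k d := ('C(k.+1, 2) + k * d)%N.

Lemma coef_r2 n i :
  (r2 n)`_i = \sum_(1 <= k < n.+2) (-1) ^+ (i + k.+1) *
    ((n == low_value k `|i%:Z - n%:Z|)%:R
     - (n == high_value k `|i%:Z - n%:Z|)%:R).
Proof.
have -> : r2 n = \sum_(1 <= k < n.+2) (-1) ^+ k.+1 *
     (bilateral_coef n k 'C(k, 2) - bilateral_coef n k 'C(k.+1, 2)).
  apply/eqP; rewrite -tofrac_eq; apply/eqP; rewrite r2P r2_seriesE rmorph_sum.
  by apply: eq_bigr => k _; rewrite rmorphM rmorphB rmorphXn rmorphN1.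
rewrite coef_sum !big_nat; apply: eq_bigr => k /andP[k_gt0 _].
rewrite coef_signM coefB !coef_bilateral_coef // exprD.
by rewrite /low_value /high_value; ring.
Qed.

(** * Signs of the contributions *)

(** If a is the odd one of k and l, and 2b the even one, then n = ab and
    s = b + (a - 1)/2, so n + s = (a + 1) b + (a - 1)/2 has the parity of
    (a - 1)/2. *)
Lemma odd_factor_sign n k l s : (k * l = n.*2)%N -> (k + l = s.*2.+1)%N ->
  exists a, [/\ (a %| n)%N, odd a & odd (n + s) = (a %% 4 == 3)%N].
Proof.
have key a b : (a.*2 * b = n.*2)%N -> (a.*2 + b = s.*2.+1)%N ->
  exists a, [/\ (a %| n)%N, odd a & odd (n + s) = (a %% 4 == 3)%N].
  move=> abn abs; exists b.
  have nE : n = (a * b)%N by nia.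
  have ob : odd b by lia.
  split=> //; first by rewrite nE dvdn_mull.
  by rewrite nE oddD oddM ob andbT; lia.
move=> kln kls; have [ok|ek] := boolP (odd k).
  have lE : l./2.*2 = l by lia.
  by apply: (key l./2 k); rewrite lE 1?mulnC 1?addnC.
have kE : k./2.*2 = k by lia.
by apply: (key k./2 l); rewrite kE.
Qed.

Lemma bin2_double k : ('C(k, 2).*2 = k * k.-1)%N.
Proof. by elim: k => // k IH; rewrite binS bin1; nia. Qed.

Lemma low_value_double k d : (0 < k)%N ->
  (k * (k + d.*2).-1 = (low_value k d).*2)%N.
Proof. by move=> k_gt0; have := bin2_double k; rewrite /low_value; nia. Qed.

Lemma high_value_double k d : (k * (k + d.*2).+1 = (high_value k d).*2)%N.
Proof. by have := bin2_double k.+1; rewrite /high_value; nia. Qed.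

Lemma low_value_sign n k d i : (0 < k)%N -> n = low_value k d ->
  odd i = odd (n + d) ->
  exists a, [/\ (a %| n)%N, odd a & odd (i + k.+1) = (a %% 4 == 3)%N].
Proof.
move=> k_gt0 nE iE; have E := low_value_double k d k_gt0.
have [||a [an oa s]] := @odd_factor_sign n k (k + d.*2).-1 (k.-1 + d).
- by rewrite nE.
- by lia.
- exists a; split=> //; rewrite -s oddD iE -oddD.
  have -> : (n + d + k.+1 = (n + (k.-1 + d)).+2)%N by clear -k_gt0; lia.
  by rewrite /= negbK.
Qed.

Lemma high_value_sign n k d i : n = high_value k d ->
  odd i = odd (n + d) ->
  exists a, [/\ (a %| n)%N, odd a & odd (i + k) = (a %% 4 == 3)%N].
Proof.
move=> nE iE; have E := high_value_double k d.
have [||a [an oa s]] := @odd_factor_sign n k (k + d.*2).+1 (k + d).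
- by rewrite nE.
- by lia.
- by exists a; split=> //; rewrite -s oddD iE -oddD addnAC addnA.
Qed.

Lemma odd_distn (i n : nat) : odd i = odd (n + `|i%:Z - n%:Z|)%N.
Proof. lia. Qed.

(** * Nonnegative coefficients *)

Lemma coef_r2_ge0 n i :
  (forall a, (a %| n)%N -> (a %% 4 == 3)%N = false) -> 0 <= (r2 n)`_i.
Proof.
move=> no3; rewrite coef_r2 big_nat; apply: sumr_ge0 => k /andP[k_gt0 _].
have oi := odd_distn i n; move: `|_|%N oi => d oi.
rewrite mulrBr subr_ge0; apply: (@le_trans _ _ 0).
  case: eqP => [/high_value_sign/(_ oi)[a [an _ s]]|_]; last by rewrite mulr0.
  by rewrite -signr_odd addnS /= s no3 // mulr1.
case: eqP => [/low_value_sign/(_ oi)[|a [an _ s]]//|_]; last by rewrite mulr0.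
by rewrite -signr_odd s no3.
Qed.

(** * Negative coefficients *)

(** For k' > 0, the number k'(k'+2d+1) lies strictly above k(k+2d-1) at k = k' and
    not above it at k = k'+1, and k(k+2d-1) increases with k. For k' = 0, a positive
    k with k(k+2d-1) = 0 is 1. *)
Lemma low_high_value k k' d :
  (0 < k)%N -> low_value k d = high_value k' d -> k = k'.+1.
Proof.
move=> k_gt0 E; have := high_value_double k' d.
by rewrite -E -low_value_double //; nia.
Qed.

Lemma high_value_inj d k k' : high_value k d = high_value k' d -> k = k'.
Proof.
move=> E; have := high_value_double k' d; rewrite -E -high_value_double {E}.
by case: (ltngtP k k') => // ltk; nia.
Qed.

(** The only other contribution that can occur comes from [low_value] at k + 1;
    the shift of k changes its sign from plus to minus, so that it reinforces the
    negative one. *)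
Lemma coef_r2_lt0 n k d :
  (0 < k)%N -> n = high_value k d -> ~~ odd (n + d + k.+1) ->
  (r2 n)`_(n + d) < 0.
Proof.
move=> k_gt0 nE ev; rewrite coef_r2.
have -> : `|(n + d)%N%:Z - n%:Z|%N = d by lia.
have term_le0 k' : (0 < k')%N -> (-1) ^+ (n + d + k'.+1) *
    ((n == low_value k' d)%:R - (n == high_value k' d)%:R) <= - (k' == k)%:R :> int.
  move=> k'_gt0; have -> : (n == high_value k' d) = (k' == k).
    by rewrite nE; apply/eqP/eqP => [/high_value_inj|->].
  case: (k' =P k) => [->|nk].
    rewrite -signr_odd (negPf ev) mul1r.
    case: eqP => // /esym; rewrite [X in _ = X]nE => /(low_high_value _ _ _ k_gt0); lia.
  case: eqP => [|_]; last by rewrite subr0 mulr0.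
  rewrite {1}nE => /esym/(low_high_value _ _ _ k'_gt0) ->.
  by rewrite -signr_odd addnS /= ev.
have kn : (k < n.+2)%N by have := high_value_double k d; rewrite -nE; nia.
apply: (@le_lt_trans _ _ (\sum_(1 <= k' < n.+2) - (k' == k)%:R)).
  rewrite big_nat [leRHS]big_nat.
  by apply: ler_sum => k' /andP[k'_gt0 _]; apply: term_le0.
rewrite (bigD1_seq k) ?iota_uniq ?mem_index_iota ?k_gt0 //= eqxx.
by rewrite big1 // => k' /negPf ->.
Qed.

(** With n = p b, the smaller one of p and 2b serves as k; the difference of the two
    is odd and determines d. *)
Lemma factor_high_value n p : (p %| n)%N -> (p %% 4 = 3)%N -> (0 < n)%N ->
  exists k d, [/\ (0 < k)%N, n = high_value k d & ~~ odd (n + d + k.+1)].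
Proof.
move=> /dvdnP[b nE] p3 n_gt0.
have b_gt0 : (0 < b)%N by lia.
have [lt|ge] := ltnP b.*2 p.
  exists b.*2, (p.-1./2 - b)%N; split; first by lia.
    apply: double_inj; rewrite -high_value_double nE.
    have -> : (b.*2 + (p.-1./2 - b).*2).+1 = p by lia.
    by lia.
  by rewrite nE !oddD oddM; lia.
exists p, (b - p.+1./2)%N; split; first by lia.
  apply: double_inj; rewrite -high_value_double nE.
  have -> : (p + (b - p.+1./2).*2).+1 = b.*2 by lia.
  by lia.
by rewrite nE !oddD oddM; lia.
Qed.

(** * Prime factors congruent to 3 modulo 4 *)

(** Strong induction: a is odd, so its least prime factor is 1 or 3 modulo 4, and
    dividing by one that is 1 modulo 4 does not change the residue of a. *)
Lemma prime_divisor_3mod4 a : a = 3 %[mod 4] ->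
  exists p, [/\ prime p, (p %| a)%N & p = 3 %[mod 4]].
Proof.
elim/ltn_ind: a => a IH a3.
have a_gt1 : (1 < a)%N by case: a a3 {IH} => [|[]].
have [pp pa] := (pdiv_prime a_gt1, pdiv_dvd a).
have [p3|p_n3] := eqVneq (pdiv a %% 4)%N 3; first by exists (pdiv a).
have p_gt1 := prime_gt1 pp.
move: pp pa p_n3 p_gt1; move: (pdiv a) => p pp /dvdnP[b aE] p_n3 p_gt1.
have p1 : (p %% 4 = 1)%N.
  have : ((b %% 4) * (p %% 4) %% 4 = 3)%N by rewrite modnMml modnMmr -aE a3.
  by move: p_n3 (ltn_pmod b (isT : 0 < 4)%N) (ltn_pmod p (isT : 0 < 4)%N);
    case: (p %% 4)%N => [|[|[|[]]]] //; case: (b %% 4)%N => [|[|[|[]]]].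
have b3 : b = 3 %[mod 4] by rewrite -a3 aE -modnMmr p1 muln1.
have [|r [pr rb r3]] := IH b _ b3; first by nia.
by exists r; split=> //; rewrite aE dvdn_mulr.
Qed.

Theorem corollary1 (n : nat) (n_gt0 : (0 < n)%N) :
  (exists i : nat, (r2 n)`_i < 0) <->
  (exists p : nat, [/\ prime p, (p %| n)%N & p = 3 %[mod 4]]).
Proof.
split=> [[i]|[p [_ pn p3]]]; last first.
  have [k [d [k_gt0 nE ev]]] := factor_high_value n p pn p3 n_gt0.
  by exists (n + d)%N; apply: coef_r2_lt0 nE ev.
have [/hasP[a]|/hasPn no3] :=
  boolP (has (fun a => a %% 4 == 3)%N (divisors n)).
  rewrite -dvdn_divisors // => an /eqP a3 _.
  have [p [pp pa p3]] := prime_divisor_3mod4 a a3.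
  by exists p; split=> //; apply: dvdn_trans an.
rewrite ltNge coef_r2_ge0 // => a; rewrite dvdn_divisors // => /no3.
exact: negPf.
Qed.
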